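(* Let $(B_t)_{t\ge 0}$ be standard one-dimensional Brownian motion started at $0$. Almost surely, the graph $G_B=\{(t,B_t):t\ge 0\}$ contains a point other than $(0,0)$ whose effective Hausdorff dimension is $<1$.
   Context: The effective Hausdorff dimension of a point $x\in 2^{\mathbb N}$ is the supremum of those $s\in[0,1]$ such that $x$ belongs to no set $\bigcap_n U_n$, where $U_n=\bigcup_{p\in\mathbb N}[\sigma_{n,p}]$ is a $\Sigma^0_1$ class uniformly in $n$ (the strings $\sigma_{n,p}$ are uniformly computably enumerated) and $\sum_p 2^{-s|\sigma_{n,p}|}\le 2^{-n}$. Here $[\sigma]$ is the set of infinite binary sequences extending the finite string $\sigma$. For a point $z\in\mathbb R^2$ the analogous notion is used: its effective Hausdorff dimension is the supremum of those $s\in[0,2]$ such that $z$ belongs to no set $\bigcap_n U_n$, where $U_n=\bigcup_{p}Q_{n,p}$, the $Q_{n,p}$ are closed dyadic squares $[i2^{-k},(i+1)2^{-k}]\times[j2^{-k},(j+1)2^{-k}]$ ($i,j\in\mathbb Z$, $k\in\mathbb N$) computably enumerated uniformly in $n$, and $\sum_p (\text{side length of }Q_{n,p})^{s}\le 2^{-n}$. *)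

(* Defs.v *)
From mathcomp Require Import all_boot all_order all_algebra.
From mathcomp Require Import all_classical all_reals all_analysis.

Set Implicit Arguments.
Unset Strict Implicit.
Unset Printing Implicit Defensive.

Import Order.TTheory GRing.Theory Num.Theory.
Import numFieldNormedType.Exports.

Local Open Scope classical_set_scope.
Local Open Scope ring_scope.

(* The total recursive functions: the least class containing the basic
   functions and closed under composition, primitive recursion and
   minimization of regular functions, i.e. of those g for which every v admits
   a y with g (y, v) = 0.  By Kleene's normal form theorem these are exactly
   the total computable functions.  Regularity is not a separate premise of
   [recursive_mu]: it is implied by the existence of h. *)
Inductive recursive : forall k : nat, (k.-tuple nat -> nat) -> Prop :=
| recursive_zero k : recursive (fun _ : k.-tuple nat => 0%N)
| recursive_succ : recursive (fun v : 1.-tuple nat => (tnth v ord0).+1)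
| recursive_proj k (i : 'I_k) : recursive (fun v : k.-tuple nat => tnth v i)
| recursive_comp k m (g : m.-tuple nat -> nat)
    (f : 'I_m -> k.-tuple nat -> nat) (h : k.-tuple nat -> nat) :
    recursive g -> (forall i, recursive (f i)) ->
    (forall v, h v = g [tuple f i v | i < m]) ->
    recursive h
| recursive_prim k (f : k.-tuple nat -> nat) (g : k.+2.-tuple nat -> nat)
    (h : k.+1.-tuple nat -> nat) :
    recursive f -> recursive g ->
    (forall v : k.-tuple nat, h [tuple of 0%N :: v] = f v) ->
    (forall y (v : k.-tuple nat), h [tuple of y.+1 :: v] =
                 g [tuple of y :: h [tuple of y :: v] :: v]) ->
    recursive h
| recursive_mu k (g : k.+1.-tuple nat -> nat) (h : k.-tuple nat -> nat) :
    recursive g ->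
    (forall v : k.-tuple nat, g [tuple of h v :: v] = 0%N) ->
    (forall (v : k.-tuple nat) y, (y < h v)%N -> g [tuple of y :: v] <> 0%N) ->
    recursive h.

Definition computable2 (f : nat -> nat -> nat) : Prop :=
  recursive (fun v : 2.-tuple nat => f (tnth v ord0) (tnth v ord_max)).

(* Integers are coded as differences of natural numbers. *)
Definition computable2Z (f : nat -> nat -> int) : Prop :=
  exists a b, [/\ computable2 a, computable2 b &
    forall n p, f n p = (a n p)%:Z - (b n p)%:Z].

Section EffectiveDimension.
Variable R : realType.

Definition dyadic_square (k : nat) (i j : int) : set (R * R) :=
  `[i%:~R * 2 ^- k, (i + 1)%:~R * 2 ^- k] `*`
  `[j%:~R * 2 ^- k, (j + 1)%:~R * 2 ^- k].

(* The square Q_{n,p} has level k n p, hence side length 2 ^- k n p, and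
   integer coordinates i n p and j n p.  The real number s itself need not be
   computable. *)
Definition effectively_null (s : R) (z : R * R) : Prop :=
  exists (k : nat -> nat -> nat) (i j : nat -> nat -> int),
    [/\ computable2 k, computable2Z i, computable2Z j,
        forall n, (\sum_(0 <= p <oo) ((2 ^- k n p) `^ s)%:E
                   <= (2 ^- n)%:E :> \bar R)%E &
        (\bigcap_n \bigcup_p dyadic_square (k n p) (i n p) (j n p)) z].

(* The set below is bounded by 2 and never empty, so that [sup] is a genuine
   supremum: for s = 0 the series diverges, so no z is effectively 0-null. *)
Definition effective_dim (z : R * R) : R :=
  sup [set s : R | 0 <= s <= 2 /\ ~ effectively_null s z].

End EffectiveDimension.

Section BrownianMotion.
Context {R : realType} {d : measure_display} {T : measurableType d}.
Variable P : probability T R.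

Definition independent_RVs (n : nat) (X : 'I_n -> T -> R) : Prop :=
  forall (J : {set 'I_n}) (A : 'I_n -> set R),
    (forall i, measurable (A i)) ->
    P (\bigcap_(i in [set` J]) X i @^-1` A i) =
    (\prod_(i in J) P (X i @^-1` A i))%E.

(* Only the times t >= 0 matter: B t is unconstrained for t < 0. The second
   parameter of [normal_prob] is the standard deviation. *)
Definition brownian_motion (B : R -> {RV P >-> R}) : Prop :=
  [/\ {ae P, forall w, B 0 w = 0},
      forall (t : nat -> R) (n : nat),
        0 <= t 0%N -> (forall i, t i < t i.+1) ->
        independent_RVs (fun i : 'I_n => B (t i.+1) \- B (t i)),
      forall s t : R, 0 <= s -> s < t ->
        forall A : set R, measurable A ->
          pushforward P (B t \- B s) A = normal_prob 0 (Num.sqrt (t - s)) A &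
      {ae P, forall w, {within `[0, +oo[, continuous (fun t => B t w)}}].

Definition graph (B : R -> {RV P >-> R}) (w : T) : set (R * R) :=
  [set z | exists2 t : R, 0 <= t & z = (t, B t w)].

End BrownianMotion.

(* Main.v *)
Require Import Defs.
From mathcomp Require Import all_boot all_order all_algebra.
From mathcomp Require Import all_classical all_reals all_analysis.
From mathcomp Require Import ring lra zify.

Set Implicit Arguments.
Unset Strict Implicit.
Unset Printing Implicit Defensive.

Import Order.TTheory GRing.Theory Num.Theory.
Import numFieldNormedType.Exports.

Local Open Scope classical_set_scope.
Local Open Scope ring_scope.

(** A Brownian path moves by about [2 ^- (6 * r)] during a time of length
    [2 ^- (12 * r)], which is far more than [2 * 2 ^- (8 * r)].  Cut the strip
    [0 <= t <= 1], [-1 <= y <= 1] by taking the abscissae that are multiples of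
    [2 ^- r] and the heights that are multiples of [2 ^- (8 * r)], and put a
    square of side [2 ^- (12 * r)] at each point of this sparse grid.  A stage
    has [O(2 ^ (9 * r))] squares, and since the 5/6-th power of the side is
    [2 ^- (10 * r)] they contribute [O(2 ^- r)] to the 5/6-dimensional
    content.  So the squares of all stages [r >= n + 10] form a cover [U_n] of
    content at most [2 ^- n], and these covers are plainly computable.

    Over a column of width [2 ^- (12 * r)] the path oscillates by at least two
    heights of the grid with probability [1 - O(2 ^- (2 * r))].  There are
    [2 ^ r] columns at stage [r], so by Borel-Cantelli almost surely all columns
    of all large stages have this property ([ae_rough]).  By the intermediate
    value theorem the path then crosses the interior of a grid square in every
    such column in which it stays between -1 and 1 ([column_crossing]).
    As the columns become dense, for each [n] the graph is in the
    interior of [U_n] at an open dense set of times of a small interval [(0, b)]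
    on which [-1 < B_t < 1] ([rough_hits]).  The Baire category theorem gives a single
    time [t > 0] that works for all [n] ([rough_low_dim]), and [(t, B_t)] has
    effective dimension at most 5/6 ([effective_dim_lt1]). *)

(** * Closure properties of the recursive functions *)

Section Recursive.
Local Open Scope nat_scope.

Lemma recursive_ext k (f g : k.-tuple nat -> nat) :
  recursive f -> f =1 g -> recursive g.
Proof. by move=> rf /funext <-. Qed.

Lemma recursive_comp1 k (g : nat -> nat) (f : k.-tuple nat -> nat) :
  recursive (fun v : 1.-tuple nat => g (tnth v ord0)) -> recursive f ->
  recursive (fun v => g (f v)).
Proof.
move=> rg rf; apply: (recursive_comp (f := fun=> f) rg) => // v.
by rewrite tnth_mktuple.
Qed.

Lemma recursive_comp2 k (g : nat -> nat -> nat) (f1 f2 : k.-tuple nat -> nat) :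
  computable2 g -> recursive f1 -> recursive f2 ->
  recursive (fun v => g (f1 v) (f2 v)).
Proof.
move=> rg r1 r2.
apply: (recursive_comp (f := fun i : 'I_2 => if i == ord0 then f1 else f2) rg).
  by move=> i; case: ifP.
by move=> v; rewrite !tnth_mktuple.
Qed.

Lemma recursive_const k c : recursive (fun _ : k.-tuple nat => c).
Proof.
elim: c => [|c IH]; first exact: recursive_zero.
exact: (recursive_comp1 recursive_succ IH).
Qed.

(** The binary instances of primitive recursion and of minimization, with the
    tuples hidden.  They serve as the only gateway to the constructors
    [recursive_prim] and [recursive_mu]. *)
Lemma computable2_prim (h : nat -> nat -> nat) (f : nat -> nat)
    (g : nat -> nat -> nat -> nat) :
  recursive (fun v : 1.-tuple nat => f (tnth v ord0)) ->
  recursive (fun v : 3.-tuple nat =>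
    g (tnth v ord0) (tnth v (lift ord0 ord0)) (tnth v ord_max)) ->
  (forall y, h 0 y = f y) -> (forall x y, h x.+1 y = g x (h x y) y) ->
  computable2 h.
Proof.
by move=> rf rg h0 hS; apply: (recursive_prim rf rg) => *;
  rewrite !(tnth_nth 0) /= ?h0 ?hS.
Qed.

(** Minimization searches for the least [z] with [g z x y = 0]; it is enough
    that this zero set is the up-set generated by [h x y]. *)
Lemma computable2_mu (h : nat -> nat -> nat) (g : nat -> nat -> nat -> nat) :
  recursive (fun v : 3.-tuple nat =>
    g (tnth v ord0) (tnth v (lift ord0 ord0)) (tnth v ord_max)) ->
  (forall x y z, (g z x y == 0) = (h x y <= z)) ->
  computable2 h.
Proof.
move=> rg gh; apply: (recursive_mu rg) => v.
  by apply/eqP; rewrite !(tnth_nth 0) /= gh.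
by move=> y hy; apply/eqP; rewrite !(tnth_nth 0) /= gh -ltnNge;
  rewrite !(tnth_nth 0) in hy.
Qed.

Lemma computable2_swap f : computable2 f -> computable2 (fun x y => f y x).
Proof. by move=> rf; apply: (recursive_comp2 rf); exact: recursive_proj. Qed.

Lemma computable2_add : computable2 addn.
Proof.
apply: (@computable2_prim _ id (fun _ h _ => h.+1)) => //.
  exact: recursive_proj.
by apply: (recursive_comp1 recursive_succ); exact: recursive_proj.
Qed.

Lemma computable2_mul : computable2 muln.
Proof.
apply: (@computable2_prim _ (fun=> 0) (fun _ h y => h + y)) => //.
- exact: recursive_zero.
- by apply: (recursive_comp2 computable2_add); exact: recursive_proj.
- by move=> x y; rewrite mulSn addnC.
Qed.

(** The predecessor is a primitive recursion that discards the recursive value;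
    the dummy second argument makes it fit [computable2_prim]. *)
Lemma recursive_pred : recursive (fun v : 1.-tuple nat => (tnth v ord0).-1).
Proof.
have p2 : computable2 (fun x _ => x.-1).
  apply: (@computable2_prim _ (fun=> 0) (fun x _ _ => x)) => //.
    exact: recursive_zero.
  exact: recursive_proj.
apply: (recursive_comp2 p2 (f2 := fun=> 0)); first exact: recursive_proj.
exact: recursive_zero.
Qed.

Lemma computable2_sub : computable2 subn.
Proof.
apply: (@computable2_swap (fun y x => x - y)).
apply: (@computable2_prim _ id (fun _ h _ => h.-1)) => //.
- exact: recursive_proj.
- by apply: (recursive_comp1 recursive_pred); exact: recursive_proj.
- exact: subn0.
- by move=> x y; rewrite subnS.
Qed.

Lemma computable2_exp : computable2 expn.
Proof.
apply: (@computable2_swap (fun y x => x ^ y)).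
apply: (@computable2_prim _ (fun=> 1) (fun _ h x => x * h)) => //.
- exact: recursive_const.
- by apply: (recursive_comp2 computable2_mul); exact: recursive_proj.
- by move=> x y; rewrite expnS.
Qed.

(** [x %/ c ^ y] is the least [z] with [x < z.+1 * c ^ y]. *)
Lemma computable2_divn_expn c : 0 < c -> computable2 (fun q r => q %/ c ^ r).
Proof.
move=> c0.
apply: (@computable2_mu _ (fun z x y => x.+1 - z.+1 * c ^ y)).
  apply: (recursive_comp2 computable2_sub).
    by apply: (recursive_comp1 recursive_succ); exact: recursive_proj.
  apply: (recursive_comp2 computable2_mul).
    by apply: (recursive_comp1 recursive_succ); exact: recursive_proj.
  apply: (recursive_comp2 computable2_exp); first exact: recursive_const.
  exact: recursive_proj.
by move=> x y z; rewrite subn_eq0 -ltn_divLR ?expn_gt0 ?c0// ltnS.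
Qed.

(** [trunc_log c x] is the least [z] with [x < c ^ z.+1]. *)
Lemma recursive_trunc_log c : 1 < c ->
  recursive (fun v : 1.-tuple nat => trunc_log c (tnth v ord0)).
Proof.
move=> c1.
have p2 : computable2 (fun x _ => trunc_log c x).
  apply: (@computable2_mu _ (fun z x _ => x.+1 - c ^ z.+1)).
    apply: (recursive_comp2 computable2_sub).
      by apply: (recursive_comp1 recursive_succ); exact: recursive_proj.
    apply: (recursive_comp2 computable2_exp); first exact: recursive_const.
    by apply: (recursive_comp1 recursive_succ); exact: recursive_proj.
  move=> x _ z; rewrite subn_eq0.
  apply/idP/idP => [xz|lz].
    have [->|x0] := posnP x; first by rewrite trunc_log0.
    by rewrite -ltnS -(ltn_exp2l _ _ c1) (leq_ltn_trans _ xz)// trunc_logP.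
  by rewrite (leq_trans (trunc_log_ltn x c1))// leq_exp2l.
apply: (recursive_comp2 p2 (f2 := fun=> 0)); first exact: recursive_proj.
exact: recursive_zero.
Qed.

End Recursive.

(** * The sequence of squares *)

(** The square number [q], for [512 ^ r <= q < 512 ^ r.+1], belongs to stage [r]
    and has side [2 ^- (12 * r)].  The remainder and the quotient of [q] by
    [2 ^ r] select its left edge and its bottom edge.  The base [512 = 2 ^ 9]
    makes a stage long enough for the [2 ^ r * 2 ^ (8 * r + 1)] grid points
    of the strip. *)
Definition stage (q : nat) : nat := trunc_log 512 q.

(** The left edge is [(q %% 2 ^ r) * 2 ^- r], measured in sides. *)
Definition col (q : nat) : nat := q %% 2 ^ stage q * 2 ^ (11 * stage q).

(** The bottom edge is [(q %/ 2 ^ r) * 2 ^- (8 * r) - 2], measured in sides.  As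
    the quotient starts from [2 ^ (8 * r)], the heights start from -1. *)
Definition row (q : nat) : int :=
  (q %/ 2 ^ stage q * 2 ^ (4 * stage q))%N%:Z
    - (2 ^ (12 * stage q).+1)%N%:Z.

(** Leaving out the stages before [n + 10] brings the content of the [n]-th cover
    down to [2 ^- n]. *)
Definition entry (n p : nat) : nat := p + 512 ^ (n + 10).

Section Computability.
Local Open Scope nat_scope.

Lemma computable2_stage : computable2 (fun n p => stage (entry n p)).
Proof.
apply: (@recursive_comp1 _ (trunc_log 512)); first exact: recursive_trunc_log.
apply: (recursive_comp2 computable2_add); first exact: recursive_proj.
apply: (recursive_comp2 computable2_exp); first exact: recursive_const.
apply: (recursive_comp2 computable2_add); first exact: recursive_proj.
exact: recursive_const.
Qed.

Lemma computable2_entry : computable2 entry.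
Proof.
apply: (recursive_comp2 computable2_add); first exact: recursive_proj.
apply: (recursive_comp2 computable2_exp); first exact: recursive_const.
apply: (recursive_comp2 computable2_add); first exact: recursive_proj.
exact: recursive_const.
Qed.

Lemma computable2_exp_stage c :
  computable2 (fun n p => 2 ^ (c * stage (entry n p))).
Proof.
apply: (recursive_comp2 computable2_exp); first exact: recursive_const.
apply: (recursive_comp2 computable2_mul); first exact: recursive_const.
exact: computable2_stage.
Qed.

Lemma computable2_level : computable2 (fun n p => 12 * stage (entry n p)).
Proof.
apply: (recursive_comp2 computable2_mul); first exact: recursive_const.
exact: computable2_stage.
Qed.

Lemma computable2_quotient :
  computable2 (fun n p => entry n p %/ 2 ^ stage (entry n p)).
Proof.
exact: (recursive_comp2 (@computable2_divn_expn 2 isT) computable2_entry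
  computable2_stage).
Qed.

Lemma computable2Z_col : computable2Z (fun n p => Posz (col (entry n p))).
Proof.
exists (fun n p => col (entry n p)), (fun _ _ => 0); split.
- apply: (recursive_comp2 computable2_mul); last exact: computable2_exp_stage.
  (* The remainder is obtained from the quotient. *)
  apply: (@recursive_ext _ (fun v =>
    let q := entry (tnth v ord0) (tnth v ord_max) in
    q - q %/ 2 ^ stage q * 2 ^ stage q)).
    apply: (recursive_comp2 computable2_sub); first exact: computable2_entry.
    apply: (recursive_comp2 computable2_mul); first exact: computable2_quotient.
    apply: (@recursive_ext _ _ _ (computable2_exp_stage 1)) => v.
    by rewrite mul1n.
  by move=> v /=; rewrite [X in X - _](divn_eq _ (2 ^ stage
    (entry (tnth v ord0) (tnth v ord_max)))) addKn.
- exact: recursive_zero.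
- by move=> n p; rewrite subr0.
Qed.

Lemma computable2Z_row : computable2Z (fun n p => row (entry n p)).
Proof.
exists (fun n p => let q := entry n p in
          q %/ 2 ^ stage q * 2 ^ (4 * stage q)),
       (fun n p => 2 ^ (12 * stage (entry n p)).+1).
split=> //.
- apply: (recursive_comp2 computable2_mul); first exact: computable2_quotient.
  exact: computable2_exp_stage.
- apply: (recursive_comp2 computable2_exp); first exact: recursive_const.
  by apply: (recursive_comp1 recursive_succ); exact: computable2_level.
Qed.

End Computability.

Section Enumeration.
Local Open Scope nat_scope.

(** Every grid square of the strip at a stage [r >= n + 10] is enumerated by the
    [n]-th cover: its number is
    [q = (2 ^ (8 * r) + m) * 2 ^ r + i] with [m = j + 2 ^ (8 * r)]. *)
Lemma entry_enumerates (n r i : nat) (j : int) : n + 10 <= r -> i < 2 ^ r ->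
  (- (2 ^ (8 * r))%N%:Z <= j < (2 ^ (8 * r))%N%:Z)%R ->
  exists p, [/\ stage (entry n p) = r,
    col (entry n p) = i * 2 ^ (11 * r) &
    row (entry n p) = (j * (2 ^ (4 * r))%N%:Z)%R].
Proof.
move=> nr ir /andP[jlo jhi].
have [m jm] : exists m : nat, (j = m%:Z - (2 ^ (8 * r))%N%:Z)%R.
  by exists (absz (j + (2 ^ (8 * r))%N%:Z)%R); lia.
have m2 : m < 2 * 2 ^ (8 * r) by lia.
set q := (2 ^ (8 * r) + m) * 2 ^ r + i.
have e9 : 512 ^ r = 2 ^ (8 * r) * 2 ^ r
  by rewrite -expnD -[512]/(2 ^ 9) -expnM; congr (_ ^ _); lia.
have qr : stage q = r.
  apply: trunc_log_eq => //; rewrite expnS e9.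
  have r0 : 0 < 2 ^ r by rewrite expn_gt0.
  by rewrite /q; nia.
have qn : 512 ^ (n + 10) <= q.
  by rewrite (@leq_trans (512 ^ r)) ?leq_exp2l// e9 /q; nia.
exists (q - 512 ^ (n + 10)); rewrite /entry subnK// /col /row qr; split => //.
- by rewrite /q modnMDl modn_small.
- rewrite /q divnMDl ?expn_gt0// divn_small// addn0 jm.
  rewrite (_ : (12 * r).+1 = (8 * r + 4 * r).+1); last by lia.
  by rewrite expnS expnD; lia.
Qed.

End Enumeration.

(** * The content of the covers *)

Section Content.
Variable R : realType.
Implicit Type s : R.

(** What matters about 5/6 is that it is below 1 and exceeds 9/12: a stage has
    [O(2 ^ (9 * r))] squares of side [2 ^- (12 * r)]. *)
Lemma powR_side s (r : nat) : 5 / 6 <= s ->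
  ((2 : R) ^- (12 * r)) `^ s <= 2 ^- (10 * r).
Proof.
move=> s56; set y : R := 2 ^- (2 * r).
have y0 : 0 <= y by rewrite invr_ge0 exprn_ge0.
have -> : (2 : R) ^- (12 * r) = y `^ 6%:R.
  by rewrite powR_mulrn// /y -exprVn -exprM -exprVn; congr (_ ^+ _); lia.
have -> : (2 : R) ^- (10 * r) = y `^ 5%:R.
  by rewrite powR_mulrn// /y -exprVn -exprM -exprVn; congr (_ ^+ _); lia.
rewrite -powRrM; apply: ger_powR.
  rewrite /y invr_gt0 exprn_gt0//= invf_le1 ?exprn_gt0//.
  by rewrite exprn_ege1// ler1n.
by rewrite -ler_pdivrMl// mulrC.
Qed.

(** Stage [K] has at most [512 ^ K.+1] squares, hence contributes at most
    [2 ^+ 9 * 2 ^- K].  The second summand on the left is the bound for the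
    stages still to come, which makes the induction on [M] go through. *)
Lemma content_stages (N M : nat) :
  \sum_(512 ^ N <= q < 512 ^ (N + M)) (2 ^- (10 * stage q) : R)
    + 2 ^+ 10 * 2 ^- (N + M) <= 2 ^+ 10 * 2 ^- N.
Proof.
elim: M => [|M IH]; first by rewrite addn0 big_geq// add0r.
apply: le_trans IH.
rewrite (@big_cat_nat _ _ _ (512 ^ (N + M)))/= ?leq_exp2l ?leq_addr ?addnS//.
rewrite -addrA lerD2l; move: (N + M)%N => K.
have -> : \sum_(512 ^ K <= q < 512 ^ K.+1) (2 ^- (10 * stage q) : R) =
    2 ^- (10 * K) *+ (512 ^ K.+1 - 512 ^ K).
  rewrite -sumr_const_nat; apply: eq_big_nat => q Kq.
  by rewrite /stage (@trunc_log_eq 512 K q).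
apply: (@le_trans _ _ (2 ^- (10 * K) *+ (512 ^ K.+1) + 2 ^+ 10 * 2 ^- K.+1)).
  by rewrite lerD2r ler_wpMn2l ?leq_subr// invr_ge0 exprn_ge0.
rewrite -[X in X + _]mulr_natr natrX (_ : 512%:R = 2 ^+ 9 :> R);
  last by rewrite -natrX.
have nz m : (2 : R) ^+ m != 0 by rewrite expf_neq0// pnatr_eq0.
rewrite -exprM (_ : 9 * K.+1 = 9 * K + 9)%N; last by lia.
rewrite (_ : 10 * K = 9 * K + K)%N; last by lia.
move: (9 * K)%N => L; rewrite ![2 ^+ (L + _)]exprD [2 ^+ K.+1]exprS.
rewrite le_eqVlt; apply/orP; left; apply/eqP.
by field; rewrite !nz.
Qed.

Lemma content_entry s n : 5 / 6 <= s ->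
  (\sum_(0 <= p <oo) (((2 : R) ^- (12 * stage (entry n p))) `^ s)%:E
    <= (2 ^- n)%:E)%E.
Proof.
move=> s56; apply: lime_le.
  by apply: is_cvg_nneseries => p _ _; rewrite lee_fin powR_ge0.
apply: nearW => m.
rewrite sumEFin lee_fin.
set N := (n + 10)%N.
apply: (@le_trans _ _ (\sum_(512 ^ N <= q < m + 512 ^ N) 2 ^- (10 * stage q))).
  rewrite -{1}[(512 ^ N)%N]add0n big_addn addnK.
  by apply: ler_sum => p _; exact: powR_side.
(* Extend the partial sum to the end of a stage. *)
have mN : (m + 512 ^ N <= 512 ^ (N + m))%N.
  have m5 : (m <= 512 ^ m - 1)%N.
    by rewrite leq_subRL ?expn_gt0// add1n ltn_expl.
  have N5 : (0 < 512 ^ N)%N by rewrite expn_gt0.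
  by rewrite expnD; nia.
apply: (@le_trans _ _ (\sum_(512 ^ N <= q < 512 ^ (N + m)) 2 ^- (10 * stage q))).
  rewrite [leRHS](@big_cat_nat _ _ _ (m + 512 ^ N))//=; last exact: leq_addl.
  by rewrite lerDl sumr_ge0// => i _; rewrite invr_ge0 exprn_ge0.
have := content_stages N m.
have -> : (2 : R) ^+ 10 * 2 ^- N = 2 ^- n.
  by rewrite /N exprD; field; rewrite expf_neq0// pnatr_eq0.
by apply: le_trans; rewrite lerDl mulr_ge0// invr_ge0 exprn_ge0.
Qed.

(** The covers witness that [z] is effectively [s]-null for all [s >= 5 / 6]. *)
Lemma effective_dim_lt1 (z : R * R) :
  (forall n, exists p,
    dyadic_square (12 * stage (entry n p)) (col (entry n p)) (row (entry n p))
      z) ->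
  effective_dim z < 1.
Proof.
move=> zU; rewrite /effective_dim; set S := [set s | _].
have S56 : ubound S (5 / 6).
  move=> s [_]; apply: contra_notP => /negP; rewrite -ltNge => /ltW s56.
  exists (fun n p => 12 * stage (entry n p))%N, (fun n p => col (entry n p)),
    (fun n p => row (entry n p)).
  split; [exact: computable2_level|exact: computable2Z_col|
    exact: computable2Z_row|by move=> n; exact: content_entry|].
  by move=> n _; have [p zp] := zU n; exists p.
have [->|/set0P S0] := eqVneq S set0; first by rewrite sup0.
by apply: le_lt_trans (ge_sup S0 S56) _; lra.
Qed.

End Content.

(** * Rough paths cross the covers *)

Section Crossing.
Variable R : realType.
Implicit Types (a b t u v h : R) (f : R -> R).

Lemma grid_point a b (r : nat) : 0 <= a -> b <= 1 ->
  2 * 2 ^- r < b - a ->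
  exists i : nat, [/\ (i < 2 ^ r)%N, a < i%:R * 2 ^- r &
    i%:R * 2 ^- r + 2 ^- (12 * r) < b].
Proof.
move=> a0 b1 rab.
have p0 : 0 < (2 : R) ^+ r by rewrite exprn_gt0.
have q0 : 0 < (2 : R) ^- r by rewrite invr_gt0.
set i := (Num.truncn (a * 2 ^+ r)).+1.
have /andP[ilo ihi] := truncn_itv (mulr_ge0 a0 (ltW p0)).
have ia : a < i%:R * 2 ^- r by rewrite ltr_pdivlMr.
have iub : i%:R * 2 ^- r <= a + 2 ^- r.
  by rewrite ler_pdivrMr// mulrDl mulVf ?gt_eqF// /i -natr1 lerD2r.
have side : (2 : R) ^- (12 * r) <= 2 ^- r.
  rewrite lef_pV2 ?posrE ?exprn_gt0// ler_eXn2l ?ltr1n//.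
  by lia.
exists i; split=> //; last by lra.
rewrite -(ltr_nat R) natrX -[ltRHS]mul1r -ltr_pdivrMr//.
by apply: lt_le_trans b1; lra.
Qed.

(** The multiple of [h] just above [u] works; there remains a room of [h] below
    [v], which takes the half side [e / 2]. *)
Lemma height_between u v h e : 0 < h -> 0 <= e <= h -> 2 * h <= v - u ->
  exists j : int, u < j%:~R * h /\ j%:~R * h + e / 2 < v.
Proof.
move=> h0 /andP[e0 eh] uv.
have /andP[lo hi] := floor_itv (u / h).
exists (Num.floor (u / h) + 1)%R; split; first by rewrite -ltr_pdivrMr.
suff : (Num.floor (u / h) + 1)%:~R * h <= u + h by lra.
by rewrite -ler_pdivlMr// mulrDl divff ?gt_eqF// intrD lerD2r.
Qed.

(** The intermediate value theorem, applied to the mid-height of a grid square,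
    gives a point of the graph inside that square.  The bounds on
    [j%:~R * h] keep the square in the strip. *)
Lemma column_crossing f t0 e h : {in `[t0, t0 + e], continuous f} ->
  0 < e <= h -> 2 * h <= `|f (t0 + e) - f t0| ->
  exists (j : int) (t : R), [/\ t0 < t < t0 + e, j%:~R * h < f t < j%:~R * h + e &
    Num.min (f t0) (f (t0 + e)) < j%:~R * h < Num.max (f t0) (f (t0 + e))].
Proof.
move=> cf /andP[e0 eh] jump.
set u := Num.min _ _; set v := Num.max _ _.
have uv : 2 * h <= v - u.
  by move: jump; rewrite /u /v; case: (ltP (f t0)) => ff;
    [rewrite gtr0_norm|rewrite ler0_norm ?opprB]; lra.
have h0 : 0 < h by lra.
have ee : 0 <= e <= h by rewrite ltW.
have [j [uj jv]] := height_between h0 ee uv.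
have [t tt ft] : exists2 t, t \in `[t0, t0 + e] & f t = j%:~R * h + e / 2.
  apply: IVT; first lra.
    by apply: continuous_in_subspaceT => x; rewrite inE/=; exact: cf.
  by apply/andP; split; rewrite -/u -/v; lra.
have ut : u < f t by rewrite ft; lra.
have vt : f t < v by rewrite ft; lra.
exists j, t; split; last 2 first.
- by rewrite ft; lra.
- by rewrite uj/=; lra.
(* [f t] is strictly between the values at the ends of the column. *)
move: tt; rewrite in_itv/= !lt_neqAle => /andP[-> ->]; rewrite !andbT.
apply/andP; split; apply/eqP => tE; move: ut vt; rewrite /u /v.
  by rewrite -tE; case: (ltP (f t0) (f (t0 + e))) => *; lra.
by rewrite tE; case: (ltP (f t0) (f (t0 + e))) => *; lra.
Qed.

(** The property of Brownian paths that is used: in all columns of all large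
    stages, the increment is at least two heights of the grid. *)
Definition rough f := \forall r \near \oo, forall i : nat, (i < 2 ^ r)%N ->
  2 * 2 ^- (8 * r) <= `|f (i%:R * 2 ^- r + 2 ^- (12 * r)) - f (i%:R * 2 ^- r)|.

Definition covered (n : nat) f : set R := [set t | exists p,
  dyadic_square (12 * stage (entry n p)) (col (entry n p)) (row (entry n p))
    (t, f t)].

Lemma height_index (r : nat) (j : int) : `|j%:~R * 2 ^- (8 * r) : R| < 1 ->
  (- (2 ^ (8 * r))%N%:Z <= j < (2 ^ (8 * r))%N%:Z)%R.
Proof.
have p8 : 0 < (2 : R) ^+ (8 * r) by rewrite exprn_gt0.
rewrite ltr_norml ltr_pdivrMr// ltr_pdivlMr// mul1r mulN1r.
have -> : (2 : R) ^+ (8 * r) = ((2 ^ (8 * r))%N%:Z)%:~R.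
  by rewrite -natrX.
by rewrite -intrN !ltr_int => /andP[/ltW -> ->].
Qed.

Lemma col_left (r i : nat) :
  ((i * 2 ^ (11 * r))%N : int)%:~R * 2 ^- (12 * r) = i%:R * 2 ^- r :> R.
Proof.
rewrite (_ : 12 * r = r + 11 * r)%N; last by lia.
rewrite exprD -pmulrn natrM natrX invfM mulrA [in RHS]mulrC mulrAC mulfK//.
by rewrite mulrC.
Qed.

Lemma row_bottom (r : nat) (j : int) :
  (j * (2 ^ (4 * r))%N%:Z)%:~R * 2 ^- (12 * r) = j%:~R * 2 ^- (8 * r) :> R.
Proof.
rewrite (_ : 12 * r = 4 * r + 8 * r)%N; last by lia.
by rewrite exprD intrM -pmulrn natrX invfM !mulrA mulfK.
Qed.

(** Take a stage at which the interval contains a whole column.  The crossing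
    point given by [column_crossing] is inside the open square, so by continuity
    the graph stays in the square around that time. *)
Lemma rough_hits f a b (n : nat) : {in `]0, +oo[, continuous f} ->
  rough f -> 0 <= a < b -> b <= 1 ->
  (forall t, a < t < b -> `|f t| < 1) ->
  exists2 t, a < t < b & (covered n f)° t.
Proof.
move=> cf rf /andP[a0 ab] b1 f1.
have ba2 : 0 < (b - a) / 2 by lra.
near \oo => r.
have : 2 * 2 ^- r < b - a.
  suff : 1 / 2 ^+ r < (b - a) / 2 by rewrite div1r; lra.
  by near: r; exact: (near_infty_natSinv_expn_lt (PosNum ba2)).
move=> /(grid_point a0 b1)[i [ir ai ib]].
have nr : (n + 10 <= r)%N by near: r; exists (n + 10)%N.
have jump : 2 * 2 ^- (8 * r) <=
    `|f (i%:R * 2 ^- r + 2 ^- (12 * r)) - f (i%:R * 2 ^- r)|.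
  by move: i ir {ai ib}; near: r.
have e0 : 0 < (2 : R) ^- (12 * r) by rewrite invr_gt0 exprn_gt0.
have eh : (2 : R) ^- (12 * r) <= 2 ^- (8 * r).
  rewrite lef_pV2 ?posrE ?exprn_gt0// ler_eXn2l ?ltr1n//.
  by lia.
move: (col_left r i) ai ib jump (e0) (eh).
move: (i%:R * 2 ^- r) => t0 colE ai ib.
have cf' x : a < x -> {for x, continuous f}.
  by move=> ax; apply: cf; rewrite in_itv/= andbT (le_lt_trans a0).
move=> jump _ _.
have [||j [t [/andP[t0t tt1] /andP[jf fj] uv]]] :=
  @column_crossing f t0 (2 ^- (12 * r)) (2 ^- (8 * r)) _ _ jump.
- move=> x; rewrite in_itv/= => /andP[t0x _]; apply: cf'.
  exact: lt_le_trans t0x.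
- by rewrite e0.
have /height_index jr : `|j%:~R * 2 ^- (8 * r) : R| < 1.
  have t0b : t0 < b by rewrite (lt_trans _ ib)// ltrDl.
  have := f1 t0; have := f1 (t0 + 2 ^- (12 * r)).
  rewrite ai t0b ib (lt_trans ai) ?ltrDl//= => /(_ isT) + /(_ isT).
  rewrite !ltr_norml => /andP[l1 u1] /andP[l2 u2]; case/andP: uv => u v.
  apply/andP; split; [apply: lt_trans u|apply: lt_trans v _].
    by rewrite lt_min l1 l2.
  by rewrite gt_max u1 u2.
have [p [ps pc pr]] := entry_enumerates nr ir jr.
exists t; first by rewrite (lt_trans ai)//= (lt_trans tt1).
have tn : t \in `]t0, t0 + 2 ^- (12 * r)[ by rewrite in_itv/= t0t.
have fn : f t \in `]j%:~R * 2 ^- (8 * r), j%:~R * 2 ^- (8 * r) + 2 ^- (12 * r)[.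
  by rewrite in_itv/= jf.
have {}tn := near_in_itvoo tn.
have {}fn := cf' t (lt_trans ai t0t) _ (near_in_itvoo fn).
near=> x; exists p; rewrite /dyadic_square ps pc pr /= !in_itv/= !intrD !mulrDl.
rewrite colE row_bottom mul1r.
have : x \in `]t0, t0 + 2 ^- (12 * r)[ by near: x.
rewrite in_itv/= => /andP[/ltW -> /ltW ->].
have : f x \in `]j%:~R * 2 ^- (8 * r), j%:~R * 2 ^- (8 * r) + 2 ^- (12 * r)[.
  by near: x.
by rewrite in_itv/= => /andP[/ltW -> /ltW ->].
Unshelve. all: by end_near.
Qed.

(** Baire category: inside a small interval [`]0, b[] on which [`|f| < 1], the
    times at which the graph is interior to the [n]-th cover form an open dense
    set, for every [n].  The set [V n] adds the complement of the interval, since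
    the Baire theorem is about dense subsets of the whole line. *)
Lemma rough_low_dim f : {within `[0, +oo[, continuous f} -> f 0 = 0 ->
  rough f -> exists2 t, 0 < t & effective_dim (t, f t) < 1.
Proof.
move=> /continuous_within_itvcyP[cf f0] f00 rf.
have [b [b0 b1 fb]] : exists b, [/\ 0 < b, b <= 1 &
    forall t, 0 < t < b -> `|f t| < 1].
  have : \forall t \near 0^'+, `|f t| < 1.
    rewrite f00 in f0; have /cvgr_norm_lt := f0.
    by move=> /(_ 1); rewrite normr0; apply.
  move=> [e /= e0 fe]; exists (Num.min e 1); split.
  - by rewrite lt_min e0/=.
  - by rewrite ge_min lexx orbT.
  - move=> t /andP[t0]; rewrite lt_min => /andP[te _].
    by apply: fe => //=; rewrite sub0r normrN gtr0_norm.
pose V n : set R^o := (~` `]0, b[ `|` covered n f)°.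
have : dense (\bigcap_n V n).
  apply: Baire => n; split; first exact: open_interior.
  move=> O [x Ox] oO.
  have [[y [Oy yb]]|Ob] := pselect (O `&` `]0, b[ !=set0); last first.
    exists x; split=> //; apply: (_ : O `<=` V n) Ox.
    by rewrite /V -open_subsetE// => y Oy; left => yb; apply: Ob; exists y.
  have oOb : open (O `&` `]0, b[) by apply: openI => //; exact: interval_open.
  have /nbhs_ballP[e /= e0 eO] := open_nbhs_nbhs (conj oOb (conj Oy yb)).
  have inO t : y <= t <= y + e / 2 -> (O `&` `]0, b[) t.
    by move=> te; apply: eO; rewrite /ball/= ltr_distlC; lra.
  have y0 : 0 < y by move: yb; rewrite /= in_itv/= => /andP[].
  have [t ty ct] : exists2 t, y < t < y + e / 2 & (covered n f)° t.
    apply: rough_hits => //; first by lra.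
      have [_] := inO (y + e / 2) ltac:(lra).
      by rewrite /= in_itv/= => /andP[_ /ltW]; move/le_trans; apply.
    move=> t ty; have [_] := inO t ltac:(lra).
    by rewrite /= in_itv/=; exact: fb.
  exists t; split; first by have [] := inO t ltac:(lra).
  by apply: interiorS ct; right.
move=> /(_ [set` `]0, b[])[||t [tb tV]].
- by exists (b / 2); rewrite /= in_itv/=; lra.
- exact: interval_open.
exists t; first by move: tb; rewrite /= in_itv/= => /andP[].
apply: effective_dim_lt1 => n.
by have /interior_subset[] := tV n I.
Qed.

End Crossing.

(** * Small increments of Brownian motion *)

(** The density of the centred normal law is at most its value at 0, and
    [sqrt (2 * pi) >= 1]. *)
Lemma normal_prob_ball (R : realType) (s h : R) : 0 < s -> 0 <= h ->
  (normal_prob 0 s `](- h)%R, h%R[ <= (2 * h / s)%:E)%E.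
Proof.
move=> s0 h0; rewrite /normal_prob.
apply: (@le_trans _ _
  (\int[lebesgue_measure]_(x in `](- h)%R, h%R[) (s^-1)%:E)%E).
  apply: ge0_le_integral => //=.
  - by move=> x _; rewrite lee_fin normal_pdf_ge0.
  - apply/measurable_realfun.measurable_EFinP.
    exact: measurable_funTS (measurable_normal_pdf 0 s).
  - move=> x _; rewrite lee_fin (le_trans (normal_pdf_ub _ _ _)) ?gt_eqF//.
    rewrite /normal_peak lef_pV2 ?posrE//; last first.
      by rewrite sqrtr_gt0 mulrn_wgt0// mulr_gt0 ?pi_gt0// exprn_gt0.
    rewrite -[leLHS](gtr0_norm s0) -sqrtr_sqr ler_sqrt.
      rewrite -mulrnAr ler_peMr ?sqr_ge0//.
      by have := pi_ge2 R; rewrite mulr2n; lra.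
    by rewrite mulrn_wge0// mulr_ge0 ?pi_ge0// sqr_ge0.
rewrite integral_cst//= lebesgue_measure_itv/= lte_fin.
case: ifPn => hh; last by rewrite mule0 lee_fin; rewrite !mulr_ge0// invr_ge0 ltW.
rewrite -EFinB -EFinM lee_fin mulrC; apply: ler_wpM2r; last by lra.
by rewrite invr_ge0 ltW.
Qed.

Section Brownian.
Context {R : realType} {d : measure_display} {T : measurableType d}.
Variables (P : probability T R) (B : R -> {RV P >-> R}).

Let increment (r i : nat) : T -> R :=
  B (i%:R * 2 ^- r + 2 ^- (12 * r)) \- B (i%:R * 2 ^- r).

Definition small_column (r i : nat) : set T :=
  increment r i @^-1` `](- (2 * 2 ^- (8 * r))), (2 * 2 ^- (8 * r))[.

Definition small_stage (r : nat) : set T :=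
  \big[setU/set0]_(i < 2 ^ r) small_column r i.

Lemma measurable_small_column r i : measurable (small_column r i).
Proof.
by rewrite -[small_column r i]setTI; apply: measurable_realfun.measurable_funB.
Qed.

Lemma measurable_small_stage r : measurable (small_stage r).
Proof. by apply: bigsetU_measurable => i _; exact: measurable_small_column. Qed.

(** The increment is normal with standard deviation [2 ^- (6 * r)]. *)
Lemma probability_small_column r i : brownian_motion B ->
  (P (small_column r i) <= (4 * 2 ^- (2 * r))%:E)%E.
Proof.
move=> [_ _ + _].
pose t0 : R := i%:R * 2 ^- r; pose t1 := t0 + 2 ^- (12 * r).
have e0 : 0 < (2 : R) ^- (12 * r) by rewrite invr_gt0 exprn_gt0.
have t00 : 0 <= t0 by rewrite mulr_ge0// invr_ge0 exprn_ge0.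
have t01 : t0 < t1 by rewrite ltrDl.
move=> /(_ t0 t1 t00 t01 _
  (measurable_itv `](- (2 * 2 ^- (8 * r))), (2 * 2 ^- (8 * r))[)).
rewrite /pushforward => Psmall; rewrite [X in (X <= _)%E]Psmall.
have -> : Num.sqrt (t1 - t0) = 2 ^- (6 * r).
  rewrite /t1 addrC addKr (_ : 12 * r = 6 * r * 2)%N; last by lia.
  by rewrite exprM -exprVn sqrtr_sqr ger0_norm// invr_ge0 exprn_ge0.
have s0 : 0 < (2 : R) ^- (6 * r) by rewrite invr_gt0 exprn_gt0.
have h0 : 0 <= 2 * (2 : R) ^- (8 * r) by rewrite mulr_ge0// invr_ge0 exprn_ge0.
apply: le_trans (normal_prob_ball s0 h0) _.
rewrite lee_fin (_ : 8 * r = 6 * r + 2 * r)%N; last by lia.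
have nz m : (2 : R) ^+ m != 0 by rewrite expf_neq0// pnatr_eq0.
rewrite exprD le_eqVlt; apply/orP; left; apply/eqP.
move: (6 * r)%N (2 * r)%N => k l.
by field; rewrite !nz.
Qed.

(** A union bound over the [2 ^ r] columns, written as the term of a geometric
    series of ratio 1/2. *)
Lemma probability_small_stage r : brownian_motion B ->
  (P (small_stage r) <= (8 / (2 ^ (r + 1))%:R)%:E)%E.
Proof.
move=> BM; apply: (@le_trans _ _ (\sum_(i < 2 ^ r) P (small_column r i))%E).
  by apply: Boole_inequality => i _; exact: measurable_small_column.
apply: (@le_trans _ _ (\sum_(i < 2 ^ r) (4 * 2 ^- (2 * r))%:E)%E).
  by apply: lee_sum => i _; exact: probability_small_column BM.
rewrite sumEFin lee_fin sumr_const card_ord -[leLHS]mulr_natr !natrX.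
have nz m : (2 : R) ^+ m != 0 by rewrite expf_neq0// pnatr_eq0.
rewrite exprD mulnC exprM le_eqVlt; apply/orP; left; apply/eqP.
by field; rewrite !nz.
Qed.

(** The first Borel-Cantelli lemma for the events [small_stage]. *)
Lemma ae_rough : brownian_motion B -> {ae P, forall w, rough (B ^~ w)}.
Proof.
move=> BM; have : P.-negligible (lim_sup_set small_stage).
  apply/negligibleP.
    apply: bigcap_measurable => // k _; apply: bigcup_measurable => j _.
    exact: measurable_small_stage.
  apply: lim_sup_set_cvg0; first exact: measurable_small_stage.
  have /cvg_lim h := @cvg_geometric_eseries_half R 8 0.
  apply: (@le_lt_trans _ _ (8 / 2 ^+ 0)%:E); last exact: ltry.
  rewrite -h//; apply: lee_nneseries => // r _; exact: probability_small_stage BM.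
apply: negligibleS => w; apply: contra_notP => ns.
have [n nt] : exists n, forall r, (n <= r)%N -> ~ small_stage r w.
  apply: contra_notP ns => /forallNP H n _.
  by have /existsNP[r /not_implyP[nr /contrapT]] := H n; exists r.
exists n => // r /= nr i ir; rewrite leNgt; apply/negP => lt.
apply: (nt r nr); rewrite /small_stage -bigcup_mkord; exists i => //.
by rewrite /small_column/= in_itv/= -ltr_norml.
Qed.

End Brownian.

Theorem proposition5p2 (R : realType) (d : measure_display)
    (T : measurableType d) (P : probability T R) (B : R -> {RV P >-> R}) :
  brownian_motion B ->
  {ae P, forall w, exists z : R * R,
    [/\ graph B w z, z <> (0, 0) & effective_dim z < 1]}.
Proof.
move=> BM; case: (BM) => B0 _ _ Bc.
apply: filterS3 B0 Bc (ae_rough BM) => w B0 Bc rB.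
have [t t0 dt] := rough_low_dim Bc B0 rB.
exists (t, B t w); split=> //; first by exists t => //; exact: ltW.
by case=> tE _; rewrite tE ltxx in t0.
Qed.
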